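(* Let $\mathbb{F}=\mathbb{R}$ or $\mathbb{F}=\mathbb{C}$, let $m\geq n\geq 1$ be integers, and let $X,Y\in M_{m\times n}(\mathbb{F})$ with $X\neq 0$. There is a unitary $A\in M_{m}(\mathbb{F})$ such that $AX=Y$ if and only if $X^*X=Y^*Y$.
   Context: $M_{m\times n}(\mathbb{F})$ is the set of $m\times n$ matrices over $\mathbb{F}$ and $M_m(\mathbb{F})=M_{m\times m}(\mathbb{F})$. $Z^*$ denotes the conjugate transpose of $Z$ (the transpose if $\mathbb{F}=\mathbb{R}$). $A\in M_m(\mathbb{F})$ is unitary if $A^*A=I$ (so unitary means real orthogonal when $\mathbb{F}=\mathbb{R}$). *)

(* Defs.v *)
From mathcomp Require Import all_boot all_order all_algebra.
From mathcomp Require Import reals complex.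

Set Implicit Arguments.
Unset Strict Implicit.
Unset Printing Implicit Defensive.

Import GRing.Theory Num.Theory.
Local Open Scope ring_scope.
Local Open Scope sesquilinear_scope.

(* Over the reals the conjugate transpose is the transpose, so "unitary" means
   orthogonal. *)
Definition real_unitary (R : realType) (m : nat) (A : 'M[R]_m) : Prop :=
  A^T *m A = 1%:M.

(* spectral.v's [unitarymx] is the condition A *m A ^t* == 1%:M instead. *)
Definition complex_unitary (R : realType) (m : nat) (A : 'M[R[i]]_m) : Prop :=
  A ^t* *m A = 1%:M.

(* Main.v *)
(** Idea: if [u] and [v] have the same norm and [w = u - v], then with
    [c = w^* u] one has [w^* w = c + c^*], which makes the generalized Householder
    reflection [1 - c^-1 w w^*] unitary; it sends [u] to [v] and fixes [w^⊥].
    The columns of [X] are then moved to those of [Y] one at a time: once [A] is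
    right on all the other columns, equality of the Gram matrices says that
    [w = A x - y] is orthogonal to these columns of [Y], so correcting [A] by the
    reflection along [w] does not disturb them. No square root is needed, so the
    argument works over any field with an involution whose standard form is
    anisotropic. *)
Require Import Defs.
From mathcomp Require Import all_boot all_order all_algebra.
From mathcomp Require Import reals complex.

Set Implicit Arguments.
Unset Strict Implicit.
Unset Printing Implicit Defensive.

Import GRing.Theory Num.Theory.
Local Open Scope ring_scope.
Local Open Scope sesquilinear_scope.

Section AnisotropicInvolution.

Variables (F : fieldType) (s : {rmorphism F -> F}).
Hypothesis sK : involutive s.
Hypothesis s_anisotropic : forall (m : nat) (w : 'cV[F]_m),
  map_mx s w^T *m w = 0 -> w = 0.

Local Notation adj A := (map_mx s A^T).

Lemma adjK (m n : nat) (A : 'M[F]_(m, n)) : adj (adj A) = A.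
Proof. by apply/matrixP=> i j; rewrite !mxE sK. Qed.

Lemma adjM (m n p : nat) (A : 'M[F]_(m, n)) (B : 'M[F]_(n, p)) :
  adj (A *m B) = adj B *m adj A.
Proof. by rewrite trmx_mul map_mxM. Qed.

Lemma adj_row_mx (m n1 n2 : nat) (A : 'M[F]_(m, n1)) (B : 'M[F]_(m, n2)) :
  adj (row_mx A B) = col_mx (adj A) (adj B).
Proof. by rewrite tr_row_mx map_col_mx. Qed.

Lemma gram_unitary (m n : nat) (A : 'M[F]_m) (X : 'M[F]_(m, n)) :
  adj A *m A = 1%:M -> adj (A *m X) *m (A *m X) = adj X *m X.
Proof. by move=> uA; rewrite adjM -mulmxA (mulmxA (adj A)) uA mul1mx. Qed.

Lemma unitary_mul (m : nat) (A B : 'M[F]_m) :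
  adj A *m A = 1%:M -> adj B *m B = 1%:M -> adj (A *m B) *m (A *m B) = 1%:M.
Proof. by move=> uA uB; rewrite gram_unitary. Qed.

Lemma reflection_exists (m : nat) (u v : 'cV[F]_m) :
  adj u *m u = adj v *m v ->
  exists H : 'M[F]_m, [/\ adj H *m H = 1%:M, H *m u = v &
    forall (n : nat) (Z : 'M[F]_(m, n)), adj Z *m (u - v) = 0 -> H *m Z = Z].
Proof.
move=> uv; set w := u - v; have wE : w = u - v by []; clearbody w.
have [w0|wN0] := eqVneq w 0.
  exists 1%:M; split; first by rewrite trmx1 map_mx1 mul1mx.
    by rewrite mul1mx; apply/eqP; rewrite -subr_eq0 -wE w0.
  by move=> n Z _; rewrite mul1mx.
pose c := (adj w *m u) 0 0.
have wu : adj w *m u = c%:M by rewrite [LHS]mx11_scalar.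
have uw : adj u *m w = (s c)%:M.
  by rewrite -[w in LHS]adjK -adjM wu tr_scalar_mx map_scalar_mx.
have ww : adj w *m w = (c + s c)%:M.
  have adjw : adj w = adj u - adj v by rewrite wE linearB /= map_mxB.
  rewrite [RHS]raddfD /= -wu -uw adjw wE !mulmxBl !mulmxBr uv.
  by rewrite opprB addrC.
(* If [c = 0], then [w^* w = c + s c = 0], and anisotropy forces [w = 0]. *)
have cN0 : c != 0.
  apply: contraNneq wN0 => c0; apply/eqP/s_anisotropic.
  by rewrite ww c0 rmorph0 addr0 raddf0.
have scN0 : s c != 0 by rewrite fmorph_eq0.
exists (1%:M - c^-1 *: (w *m adj w)); split.
- rewrite [(_ - _)^T]linearB /= map_mxB linearZ /= map_mxZ adjM adjK trmx1 map_mx1.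
  rewrite mulmxBl mul1mx mulmxBr mulmx1 -scalemxAl -scalemxAr.
  rewrite -mulmxA (mulmxA (adj w)) ww mul_scalar_mx -scalemxAr !scalerA fmorphV.
  (* The quadratic term of [H^* H] has this coefficient on [w w^*]; it cancels the two linear
     terms. *)
  have -> : (s c)^-1 * (c^-1 * (c + s c)) = (s c)^-1 + c^-1.
    by rewrite !mulrDr mulVf // mulr1 mulrCA mulVf // mulr1.
  by rewrite scalerDl opprB [X in _ + X]addrAC subrr add0r subrK.
- rewrite mulmxBl mul1mx -scalemxAl -mulmxA wu mul_mx_scalar scalerA.
  by rewrite mulVf // scale1r wE subKr.
- move=> n Z Zw; rewrite mulmxBl mul1mx -scalemxAl -mulmxA.
  have -> : adj w *m Z = 0 by rewrite -[Z]adjK -adjM Zw trmx0 map_mx0.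
  by rewrite mulmx0 scaler0 subr0.
Qed.

Lemma gram_eq_unitary (m n : nat) (X Y : 'M[F]_(m, n)) :
  adj X *m X = adj Y *m Y ->
  exists A : 'M[F]_m, adj A *m A = 1%:M /\ A *m X = Y.
Proof.
elim: n X Y => [|n IHn] X Y.
  move=> _; exists 1%:M; split; first by rewrite trmx1 map_mx1 mul1mx.
  by apply/matrixP=> i [].
rewrite -[n.+1]/(1 + n)%N in X Y *.
rewrite -[X]hsubmxK -[Y]hsubmxK.
move: (lsubmx X) (rsubmx X) (lsubmx Y) (rsubmx Y) => x X' y Y'.
(* Blocks of the Gram matrices: the corner gives [x] and [y] equal norms, the lower left gives
   [X'^* x = Y'^* y], and the lower right feeds the induction. *)
rewrite !adj_row_mx !mul_col_row => /eq_block_mx[xy _ X'x /IHn[A [uA AX']]].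
have [|H [uH HAx HZ]] := @reflection_exists m (A *m x) y.
  by rewrite gram_unitary.
exists (H *m A); split; first exact: unitary_mul.
rewrite -mulmxA mul_mx_row mul_mx_row HAx AX' HZ //.
by rewrite mulmxBr -X'x -AX' adjM -mulmxA (mulmxA (adj A)) uA mul1mx subrr.
Qed.

Lemma unitary_map_iff (m n : nat) (X Y : 'M[F]_(m, n)) :
  (exists A : 'M[F]_m, adj A *m A = 1%:M /\ A *m X = Y) <->
  adj X *m X = adj Y *m Y.
Proof.
split=> [[A [uA <-]]|]; last exact: gram_eq_unitary.
by rewrite gram_unitary.
Qed.

End AnisotropicInvolution.

(** Here [w^* w] is a sum of squared absolute values, so it vanishes only if every term does. *)
Lemma sum_norm_anisotropic (F : numDomainType) (s : F -> F) (m : nat)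
    (w : 'cV[F]_m) :
  (forall x, s x * x = `|x| ^+ 2) -> map_mx s w^T *m w = 0 -> w = 0.
Proof.
move=> sE /matrixP/(_ 0 0); rewrite !mxE.
under eq_bigr do rewrite !mxE sE.
move=> /psumr_eq0P w0; apply/matrixP=> i j; rewrite ord1 mxE.
apply/eqP; rewrite -normr_eq0 -sqrf_eq0; apply/eqP; apply: w0 => // k _.
by rewrite exprn_ge0.
Qed.

Theorem theorem6p1 (R : realType) (m n : nat) (n_ge1 : (1 <= n)%N)
    (m_ge_n : (n <= m)%N) :
  (forall X Y : 'M[R]_(m, n), X <> 0 ->
     ((exists A : 'M[R]_m, real_unitary A /\ A *m X = Y) <->
      X^T *m X = Y^T *m Y))
  /\
  (forall X Y : 'M[R[i]]_(m, n), X <> 0 ->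
     ((exists A : 'M[R[i]]_m, complex_unitary A /\ A *m X = Y) <->
      X ^t* *m X = Y ^t* *m Y)).
Proof.
split=> X Y _.
(* The involution is the identity over the reals and conjugation over the complex numbers. *)
- have sq (x : R) : idfun x * x = `|x| ^+ 2 by rewrite real_normK ?num_real.
  have := @unitary_map_iff R idfun (fun=> erefl)
    (fun k w => @sum_norm_anisotropic R idfun k w sq) m n X Y.
  rewrite !map_mx_id //= => <-; rewrite /real_unitary.
  by split=> -[A [uA AX]]; exists A; split=> //; move: uA; rewrite map_mx_id.
- have sq (x : R[i]) : Num.conj x * x = `|x| ^+ 2 by rewrite normCKC.
  exact: (unitary_map_iff (@conjCK _)
    (fun k w => @sum_norm_anisotropic _ Num.conj k w sq)).
Qed.
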